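(* Let $Q>1$, let $(X,d)$ be a $Q$-doubling metric space, let $0<q<1$ and $\lambda\ge 1$, and let $G\subsetneq X$ be a locally $(q,\lambda)$-quasiconvex domain. Then $G$ is a length John domain if and only if $G$ is a diameter John domain.
   Context: A domain is a nonempty open connected set. For $G\subsetneq X$ put $\delta_G(z)=\inf\{d(z,y): y\in X\setminus G\}$. $B(x,r)=\{y\in X: d(x,y)<r\}$. A curve is a continuous map $\gamma:[a,b]\to X$, identified with its image when convenient; it joins $x$ and $y$ if $\gamma(a)=x$, $\gamma(b)=y$; its length is $\ell(\gamma)=\sup\sum_i d(\gamma(t_i),\gamma(t_{i-1}))$ over all partitions of $[a,b]$, and $\gamma$ is rectifiable if $\ell(\gamma)<\infty$. For points $u,v$ on $\gamma$, $\gamma[u,v]$ is the subcurve with endpoints $u,v$ (points on $\gamma$ are understood together with their parameter values, so for $z=\gamma(t)$, $\gamma[x,z]=\gamma|_{[a,t]}$ and $\gamma[z,y]=\gamma|_{[t,b]}$). A domain $G$ is rectifiably connected if every two points of $G$ can be joined by a rectifiable curve in $G$. $Q$-doubling: for each ball $B(x,r)$, every $r/2$-separated subset of $B(x,r)$ has cardinality at most $Q$, where a set $S$ is $\sigma$-separated if $d(u,v)\ge\sigma$ for all distinct $u,v\in S$. Locally $(q,\lambda)$-quasiconvex ($0<q<1$, $\lambda\ge1$): $G$ is rectifiably connected and for every $x\in G$ and all $y,z\in B(x,q\,\delta_G(x))$ there is a curve $\gamma$ in $G$ joining $y$ and $z$ with $\ell(\gamma)\le\lambda\, d(y,z)$.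 Length $c$-John domain ($c\ge1$): every pair $x,y\in G$ can be joined by a rectifiable curve $\gamma\subset G$ with $\min\{\ell(\gamma[x,z]),\ell(\gamma[z,y])\}\le c\,\delta_G(z)$ for all $z\in\gamma$. Diameter $c$-John domain: the same with $\ell$ replaced by the diameter $\operatorname{diam}$ in this inequality (the curve is still rectifiable). $G$ is length (resp. diameter) John if it is length (resp. diameter) $c$-John for some $c\ge1$. *)

(* Defs.v *)
From mathcomp Require Import all_boot all_order all_algebra.
From mathcomp Require Import all_classical all_reals all_analysis.

Set Implicit Arguments.
Unset Strict Implicit.
Unset Printing Implicit Defensive.

Import Order.TTheory GRing.Theory Num.Theory.
Import numFieldNormedType.Exports.

Local Open Scope classical_set_scope.
Local Open Scope ring_scope.

Section Definitions.
Context {R : realType} {X : metricType R}.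
Implicit Types (G A S : set X) (a b t c : R) (g : R -> X) (x y z : X).

Definition is_domain G := [/\ G !=set0, open G & connected G].

(* The infimum is a genuine one whenever G is a proper subset of X. *)
Definition bdist G z : R := inf [set mdist z y | y in ~` G].

Definition dist_separated (sigma : R) S :=
  forall u v, S u -> S v -> u != v -> sigma <= mdist u v.

(* The cardinality bound entails finiteness: `I_n is the set {0, ..., n-1}. *)
Definition doubling (Q : R) :=
  forall x (r : R), 0 < r ->
  forall S, S `<=` ball x r -> dist_separated (r / 2) S ->
  exists2 n : nat, (S #= `I_n)%card & n%:R <= Q.

(* A curve [a, b] -> X is a total function g : R -> X considered on `[a, b]
   only; its subcurves are obtained by changing the endpoints. *)
Definition is_curve a b g := a <= b /\ {within `[a, b], continuous g}.

Definition joins_in G a b g x y :=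
  [/\ is_curve a b g, g @` `[a, b] `<=` G, g a = x & g b = y].

(* Metric-valued analogue of the library's variation: a partition
   a < s_0 < ... < s_k = b is encoded by the list s, without its first point;
   it is empty when a = b. *)
Definition curve_variation a b g (s : seq R) : R :=
  let F := g \o nth b (a :: s) in \sum_(0 <= i < size s) mdist (F i.+1) (F i).

Definition curve_length a b g : \bar R :=
  ereal_sup [set (curve_variation a b g s)%:E | s in itv_partition a b].

Definition rectifiable a b g := (curve_length a b g < +oo)%E.

(* Meant for nonempty sets: the empty set is given the value -oo. *)
Definition diam A : \bar R :=
  ereal_sup [set (mdist u v)%:E | u in A & v in A].

Definition curve_diam a b g : \bar R := diam (g @` `[a, b]).

Definition rectifiably_connected G :=
  forall x y, G x -> G y ->
  exists a b g, joins_in G a b g x y /\ rectifiable a b g.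

Definition locally_quasiconvex (q lambda : R) G :=
  rectifiably_connected G /\
  forall x, G x ->
  forall y z, ball x (q * bdist G x) y -> ball x (q * bdist G x) z ->
  exists a b g, joins_in G a b g y z /\
    (curve_length a b g <= (lambda * mdist y z)%:E)%E.

(* Common shape of the two John conditions; [msr a b g] measures g on [a, b].
   Quantifying over parameters t rather than over image points makes the two
   subcurves at g t unambiguous for curves that are not injective. *)
Definition john_with (msr : R -> R -> (R -> X) -> \bar R) c G :=
  forall x y, G x -> G y ->
  exists a b g, [/\ joins_in G a b g x y, rectifiable a b g &
    forall t, t \in `[a, b] ->
      (Order.min (msr a t g) (msr t b g) <= (c * bdist G (g t))%:E)%E].

Definition length_john_with c G := john_with curve_length c G.

Definition diameter_john_with c G := john_with curve_diam c G.

Definition length_john G := exists2 c, 1 <= c & length_john_with c G.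

Definition diameter_john G := exists2 c, 1 <= c & diameter_john_with c G.

End Definitions.

Arguments doubling {R} X Q.

(* Main.v *)
(* A diameter John curve from x to y is cut at the parameter where the
   diameters of its two subcurves balance.  On the half starting at x, every
   point u satisfies d(x, v) <= c * bdist u for all v before u, and likewise
   for the half starting at y; it suffices to replace each half by a curve
   whose length up to any of its points u is at most C * bdist u.  Proceed
   scale by scale: from its first point at distance M from x on, and as long as
   it stays within distance 2 M, the half is at distance >= M / c from the
   complement of G.  A shortest chain in this piece with steps < kappa M has, by
   doubling, a number of steps bounded independently of M, and local
   quasiconvexity replaces every step by a curve of length <= lambda kappa M.
   The length added at scale M is thus O(M), and these lengths sum
   geometrically. *)
Require Import Defs.
From mathcomp Require Import all_boot all_order all_algebra.
From mathcomp Require Import all_classical all_reals all_analysis.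
From mathcomp Require Import zify ring lra.

Set Implicit Arguments.
Unset Strict Implicit.
Unset Printing Implicit Defensive.

Import Order.TTheory GRing.Theory Num.Theory.
Import numFieldNormedType.Exports.

Local Open Scope classical_set_scope.
Local Open Scope ring_scope.

(** * Curves, their lengths and diameters *)

Section Curves.
Context {R : realType} {X : metricType R}.
Implicit Types (G : set X) (a b t L : R) (g : R -> X) (x y z : X).

Lemma ball_mdist x (r : R) y : ball x r y <-> mdist x y < r.
Proof. by rewrite ballEmdist. Qed.

(** Epsilon-delta form relative to [a, b], so that gluing and reversing curves avoid subspace
    topologies. *)
Definition eps_continuous a b g := forall t, a <= t <= b -> forall e : R, 0 < e ->
  exists2 d : R, 0 < d &
    forall u, a <= u <= b -> `|t - u| < d -> mdist (g t) (g u) < e.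

Lemma eps_continuousP a b g :
  {within `[a, b], continuous g} <-> eps_continuous a b g.
Proof.
rewrite subspace_continuousP; split => [gc t tab e e0|gc t /=].
  have /gc : [set` `[a, b]] t by rewrite /= in_itv.
  move=> /(metricType_numDomainType.cvgrPdist_lt)/(_ e e0)/=.
  rewrite nearE => -[d /= d0 H]; exists d => // u uab tu.
  by apply: H; rewrite //= in_itv.
rewrite in_itv /= => tab; apply/metricType_numDomainType.cvgrPdist_lt => e e0.
have [d d0 H] := gc t tab e e0; exists d => //= u tu.
by rewrite in_itv /= => uab; exact: H.
Qed.

(* Weakly increasing parameters, repetitions allowed, in place of partitions:
   restricting, translating, reversing and concatenating curves then act
   directly on the sequences. *)
Definition length_le a b g L := forall (t : nat -> R) (n : nat),
  (forall i, t i <= t i.+1) -> (forall i, a <= t i <= b) ->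
  \sum_(i < n) mdist (g (t i)) (g (t i.+1)) <= L.

Lemma length_le_sub a b a' b' g L L' : a <= a' -> b' <= b -> L <= L' ->
  length_le a b g L -> length_le a' b' g L'.
Proof.
move=> aa bb LL H t n t1 t2; apply: le_trans LL; apply: H => // i.
by have /andP[? ?] := t2 i; rewrite (le_trans aa)// (le_trans _ bb).
Qed.

Lemma length_le_eq a b g h L : (forall t, a <= t <= b -> g t = h t) ->
  length_le a b g L -> length_le a b h L.
Proof.
move=> gh H t n t1 t2; rewrite (le_trans _ (H t n t1 t2))//.
by apply: ler_sum => i _; rewrite !gh.
Qed.

Lemma mdist_length_le a b g L s t : length_le a b g L ->
  a <= s -> s <= t -> t <= b -> mdist (g s) (g t) <= L.
Proof.
move=> H as_ st tb; pose f i := if i is 0%N then s else t.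
have := H f 1%N; rewrite big_ord1; apply=> -[|i] //=.
  by rewrite as_ (le_trans st).
by rewrite tb (le_trans as_).
Qed.

Lemma length_le_shift a b (h : R) g L : length_le a b g L ->
  length_le (a + h) (b + h) (fun t => g (t - h)) L.
Proof.
move=> H t n t1 t2; apply: (H (fun i => t i - h)) => i; first by rewrite lerB.
by have := t2 i; rewrite lerBrDr lerBlDr.
Qed.

Lemma length_le_rev a b g L : length_le a b g L ->
  length_le (- b) (- a) (fun t => g (- t)) L.
Proof.
move=> H t n t1 t2.
have tm : {homo t : i j / (i <= j)%N >-> i <= j} by exact/nondecreasing_seqP.
(* Truncated subtraction makes the reversed sequence constant past [n], hence monotone
   everywhere. *)
have := H (fun i => - t (n - i)%N) n.
rewrite (reindex_inj rev_ord_inj) /=; under eq_bigr => i _.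
  rewrite /= ?opprK subKn// subnSK// subKn; last exact: ltnW.
  rewrite metric_sym; over.
apply=> i; first by rewrite lerN2 tm//; lia.
by have := t2 (n - i)%N; rewrite lerNr lerNl andbC.
Qed.

(** Parameters are clamped to either side of [b]. If [s] and [t] lie on the same side, one summand
    vanishes; otherwise this is the triangle inequality through [g b]. *)
Lemma mdist_minmax g (s t b : R) : mdist (g s) (g t) <=
  mdist (g (Num.min s b)) (g (Num.min t b)) +
  mdist (g (Num.max s b)) (g (Num.max t b)).
Proof.
case: (leP s b) => sb; case: (leP t b) => tb; rewrite ?mdistxx ?addr0 ?add0r//.
  exact: metric_triangle.
by rewrite addrC metric_triangle.
Qed.

(** The clamped sequences remain weakly increasing and lie in the two subintervals, so [b] need not
    be inserted as a splitting point. *)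
Lemma length_le_cat a b c g L M : a <= b -> b <= c ->
  length_le a b g L -> length_le b c g M -> length_le a c g (L + M).
Proof.
move=> ab bc H1 H2 t n t1 t2.
have := lerD (H1 (fun i => Num.min (t i) b) n _ _)
             (H2 (fun i => Num.max (t i) b) n _ _).
rewrite -big_split /= => H; apply: le_trans (H _ _ _ _) => {H}.
- by apply: ler_sum => i _; exact: mdist_minmax.
- by move=> i; rewrite le_min !ge_min t1 lexx orbT.
- by move=> i; have /andP[? ?] := t2 i; rewrite le_min ge_min lexx orbT ab !andbT.
- by move=> i; rewrite ge_max !le_max t1 lexx orbT.
- by move=> i; have /andP[? ?] := t2 i; rewrite le_max ge_max lexx orbT bc !andbT.
Qed.

Lemma curve_variation_cons a b g u (s : seq R) :
  curve_variation a b g (u :: s) = mdist (g a) (g u) + curve_variation u b g s.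
Proof. by rewrite /curve_variation /= big_nat_recl// metric_sym. Qed.

Lemma sum_le_curve_length a b g (t : nat -> R) n : a <= b ->
  (forall i, t i <= t i.+1) -> (forall i, a <= t i <= b) ->
  ((\sum_(i < n) mdist (g (t i)) (g (t i.+1)))%:E <= curve_length a b g)%E.
Proof.
move=> ab t1 t2.
(* Starting the partition at [t 0] lets the induction shift the sequence; repeated parameters, which
   a partition forbids, contribute 0 and are dropped. *)
suff [s sp st] : exists2 s, itv_partition (t 0) b s &
    \sum_(i < n) mdist (g (t i)) (g (t i.+1)) <= curve_variation (t 0) b g s.
  have /andP[at0 t0b] := t2 0%N.
  move: at0; rewrite le_eqVlt => /orP[/eqP at0|at0].
    apply: le_trans (ereal_sup_ubound _); last by exists s; rewrite ?at0.
    by rewrite lee_fin ?at0.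
  apply: le_trans (ereal_sup_ubound _); last first.
    by exists (t 0%N :: s) => //; case: sp => ? ?; split => //=; rewrite at0.
  by rewrite lee_fin curve_variation_cons (le_trans st)// lerDr mdist_ge0.
elim: n t t1 t2 => [|n IH] t t1 t2.
  rewrite big_ord0; have /andP[_ t0b] := t2 0%N.
  move: t0b; rewrite le_eqVlt => /orP[/eqP ->|t0b].
    by exists [::]; [split|rewrite /curve_variation big_nil].
  exists [:: b]; first exact: itv_partition1.
  by rewrite curve_variation_cons addr_ge0 ?mdist_ge0// /curve_variation big_nil.
have [s sp st] := IH (t \o S) (fun i => t1 i.+1) (fun i => t2 i.+1).
rewrite big_ord_recl /=; have := t1 0%N; rewrite le_eqVlt => /orP[/eqP t01|t01].
  exists s; first by rewrite t01.
  by rewrite t01 mdistxx add0r.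
exists (t 1%N :: s); first by case: sp => ? ?; split => //=; rewrite t01.
by rewrite curve_variation_cons lerD2l.
Qed.

Lemma curve_length_leP a b g L : a <= b ->
  (curve_length a b g <= L%:E)%E <-> length_le a b g L.
Proof.
move=> ab; split=> [gL t n t1 t2|gL].
  by rewrite -lee_fin (le_trans _ gL)// sum_le_curve_length.
apply: ge_ereal_sup => _ [s [sp /eqP sb] <-]; rewrite lee_fin.
have sa : sorted <%R (a :: s) by [].
(* The default value [b] of [nth] continues the partition by a constant past its end. *)
have nb i : a <= nth b (a :: s) i <= b.
  have [ii|ii] := ltnP i (size (a :: s)); last by rewrite nth_default ?ab /=.
  have ss := sorted_ltn_nth lt_trans b sa.
  apply/andP; split.
    by case: i ii => // i ii; apply/ltW/(ss 0%N i.+1).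
  rewrite -[leRHS]sb (last_nth b).
  have [->//|ne] := eqVneq i (size s).
  by apply/ltW/ss => //; rewrite ?inE /=; move: ii ne => /=; lia.
have n1 i : nth b (a :: s) i <= nth b (a :: s) i.+1.
  have [ii|ii] := ltnP i.+1 (size (a :: s)).
    by apply/ltW/(sorted_ltn_nth lt_trans) => //; rewrite inE ltnW.
  by rewrite [leRHS]nth_default//; case/andP: (nb i).
rewrite /curve_variation /= big_mkord; apply: le_trans (gL _ (size s) n1 nb).
by apply: ler_sum => i _; rewrite metric_sym.
Qed.

Lemma curve_diam_le_length a b g : (curve_diam a b g <= curve_length a b g)%E.
Proof.
apply: ge_ereal_sup => _ [_ [s + <-] [_ [t + <-] <-]].
rewrite /= !in_itv /=.
wlog st : s t / s <= t => [H /andP[s1 s2] /andP[t1 t2]|/andP[s1 s2] /andP[t1 t2]].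
  have [st|/ltW ts] := leP s t; first by rewrite H ?s1 ?t1.
  by rewrite metric_sym H ?s1 ?t1.
have ab := le_trans s1 s2.
pose f i := if i is 0%N then s else t.
have := @sum_le_curve_length a b g f 1 ab; rewrite big_ord1; apply=> -[|i] //=.
  by rewrite s1 s2.
by rewrite t1 t2.
Qed.

Lemma curve_diam_sub a b a' b' g : a <= a' -> b' <= b ->
  (curve_diam a' b' g <= curve_diam a b g)%E.
Proof.
move=> aa bb; apply: ereal_sup_le => _ [_ [s + <-] [_ [t + <-] <-]].
rewrite /= !in_itv /= => /andP[s1 s2] /andP[t1 t2].
exists (g s).
  by exists s; rewrite //= in_itv /= (le_trans aa)// (le_trans s2).
by exists (g t) => //; exists t; rewrite //= in_itv /= (le_trans aa)// (le_trans t2).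
Qed.

Lemma mdist_curve_diam a b g s t : a <= s <= b -> a <= t <= b ->
  ((mdist (g s) (g t))%:E <= curve_diam a b g)%E.
Proof.
move=> sab tab; apply: ereal_sup_ubound; exists (g s).
  by exists s; rewrite //= in_itv.
by exists (g t) => //; exists t; rewrite //= in_itv.
Qed.

End Curves.

(** * Distance to the complement *)

Section BoundaryDistance.
Context {R : realType} {X : metricType R}.
Implicit Types (G : set X) (x y z : X).

Let has_inf_bdist G z : G `<` setT -> has_inf [set mdist z y | y in ~` G].
Proof.
move=> [_ /existsNP[y /not_implyP[_ Gy]]]; split; first by exists (mdist z y), y.
by exists 0 => _ [w _ <-]; exact: mdist_ge0.
Qed.

Lemma bdist_lipschitz G z w : G `<` setT -> bdist G z <= bdist G w + mdist z w.
Proof.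
move=> GT; have [w0 _] := has_inf_bdist w GT; have [_ zb] := has_inf_bdist z GT.
rewrite -lerBlDr; apply: lb_le_inf => // _ [y Gy <-].
apply: (@le_trans _ _ (mdist z y - mdist z w)).
  by rewrite lerB// ge_inf//; exists y.
by rewrite lerBlDl metric_triangle.
Qed.

Lemma bdist_gt0 G z : G `<` setT -> open G -> G z -> 0 < bdist G z.
Proof.
move=> GT Go Gz; have [z0 _] := has_inf_bdist z GT.
have /nbhs_ballP[e /= e0 eG] := open_nbhs_nbhs (conj Go Gz).
apply: lt_le_trans e0 _; apply: lb_le_inf => // _ [y Gy <-].
by rewrite leNgt; apply/negP => zy; apply/Gy/eG/ball_mdist.
Qed.

End BoundaryDistance.

(** * Concatenation and reversal of curves *)

Section Concatenation.
Context {R : realType} {X : metricType R}.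
Implicit Types (G : set X) (a b t L : R) (g : R -> X) (x y z : X).

Lemma eps_continuous_sub a b a' b' g : a <= a' -> b' <= b ->
  eps_continuous a b g -> eps_continuous a' b' g.
Proof.
move=> aa bb H t /andP[t1 t2] e e0.
have [|d d0 dP] := H t _ e e0; first by rewrite (le_trans aa)// (le_trans t2).
by exists d => // u /andP[u1 u2]; apply: dP; rewrite (le_trans aa)// (le_trans u2).
Qed.

Lemma eps_continuous_eq a b g h : (forall t, a <= t <= b -> g t = h t) ->
  eps_continuous a b g -> eps_continuous a b h.
Proof.
move=> gh H t tab e e0; have [d d0 dP] := H t tab e e0.
by exists d => // u uab; rewrite -!gh//; exact: dP.
Qed.

Lemma eps_continuous_shift a b (h : R) g : eps_continuous a b g ->
  eps_continuous (a + h) (b + h) (fun t => g (t - h)).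
Proof.
move=> H t tab e e0.
have [|d d0 dP] := H (t - h) _ e e0; first by rewrite lerBrDr lerBlDr.
exists d => // u uab tu; apply: dP; first by rewrite lerBrDr lerBlDr.
by rewrite opprB addrA subrK.
Qed.

Lemma eps_continuous_rev a b g : eps_continuous a b g ->
  eps_continuous (- b) (- a) (fun t => g (- t)).
Proof.
move=> H t tab e e0.
have [|d d0 dP] := H (- t) _ e e0; first by rewrite lerNr lerNl andbC.
exists d => // u uab tu; apply: dP; first by rewrite lerNr lerNl andbC.
by rewrite -opprB normrN opprK addrC.
Qed.

Lemma eps_continuous_cat a b c g : a <= b -> b <= c ->
  eps_continuous a b g -> eps_continuous b c g -> eps_continuous a c g.
Proof.
move=> ab bc H1 H2 t /andP[ta tc] e e0; have e20 : 0 < e / 2 by rewrite divr_gt0.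
have mn u : a <= u -> a <= Num.min u b <= b.
  by move=> au; rewrite le_min ge_min au ab lexx orbT.
have mx u : u <= c -> b <= Num.max u b <= c.
  by move=> uc; rewrite ge_max le_max uc bc lexx orbT.
have [d1 d10 d1P] := H1 _ (mn t ta) _ e20.
have [d2 d20 d2P] := H2 _ (mx t tc) _ e20.
exists (Num.min d1 d2); first by rewrite lt_min d10.
move=> u /andP[ua uc]; rewrite lt_min => /andP[tu1 tu2].
have tu := ler_norm (t - u); have ut : u - t <= `|t - u| by rewrite distrC ler_norm.
apply: le_lt_trans (mdist_minmax g t u b) _; rewrite (splitr e) ltrD//.
- apply: d1P (mn u ua) (le_lt_trans _ tu1).
  by case: (leP t b); case: (leP u b); rewrite // ler_norml; lra.
- apply: d2P (mx u uc) (le_lt_trans _ tu2).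
  by case: (leP t b); case: (leP u b); rewrite // ler_norml; lra.
Qed.

Lemma joins_inP G a b g x y : joins_in G a b g x y <->
  [/\ a <= b, eps_continuous a b g, forall t, a <= t <= b -> G (g t),
      g a = x & g b = y].
Proof.
split=> [[[ab /eps_continuousP gc] gG ga gb]|[ab gc gG ga gb]].
  by split=> // t tab; apply: gG; exists t; rewrite //= in_itv.
split=> //; first by split=> //; exact/eps_continuousP.
by move=> _ [t + <-]; rewrite /= in_itv => /gG.
Qed.

Definition cat_curve b a' g g' := fun t => if t <= b then g t else g' (t - (b - a')).

Lemma cat_curvel b a' g g' t : t <= b -> cat_curve b a' g g' t = g t.
Proof. by rewrite /cat_curve => ->. Qed.

Lemma cat_curver b a' g g' t : g b = g' a' -> b <= t ->
  cat_curve b a' g g' t = g' (t - (b - a')).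
Proof.
rewrite /cat_curve => bb; rewrite le_eqVlt => /orP[/eqP <-|].
  by rewrite lexx bb subKr.
by rewrite ltNge => /negbTE ->.
Qed.

Lemma length_le_catr b a' b' g g' t L : g b = g' a' -> a' <= t ->
  length_le t b' g' L ->
  length_le (t + (b - a')) (b' + (b - a')) (cat_curve b a' g g') L.
Proof.
move=> bb at' Lg; have := length_le_shift (h := b - a') Lg.
apply: length_le_eq => s /andP[ts sb].
by rewrite cat_curver// (le_trans _ ts)// addrCA lerDl subr_ge0.
Qed.

Lemma joins_in_cat G a b g x y a' b' g' z :
  joins_in G a b g x y -> joins_in G a' b' g' y z ->
  joins_in G a (b' + (b - a')) (cat_curve b a' g g') x z.
Proof.
move=> /joins_inP[ab gc gG ga gb] /joins_inP[ab' gc' gG' ga' gb'].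
have bb : g b = g' a' by rewrite gb.
have bc : b <= b' + (b - a') by rewrite addrCA lerDl subr_ge0.
apply/joins_inP; split.
- exact: le_trans bc.
- apply: (eps_continuous_cat ab bc).
    by apply: eps_continuous_eq gc => t /andP[_ tb]; rewrite cat_curvel.
  have := eps_continuous_shift (h := b - a') gc'; rewrite subrKC => H.
  by apply: eps_continuous_eq H => t /andP[bt _]; rewrite cat_curver.
- move=> t /andP[ta tc]; have [tb|/ltW tb] := leP t b.
    by rewrite cat_curvel//; apply: gG; rewrite ta.
  by rewrite cat_curver//; apply: gG'; apply/andP; split; lra.
- by rewrite cat_curvel.
- by rewrite cat_curver// addrK.
Qed.

Lemma joins_in_rev G a b g x y :
  joins_in G a b g x y -> joins_in G (- b) (- a) (fun t => g (- t)) y x.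
Proof.
move=> /joins_inP[ab gc gG ga gb]; apply/joins_inP; split; rewrite ?opprK ?lerN2//.
- exact: eps_continuous_rev.
- by move=> t tab; apply: gG; rewrite lerNr lerNl andbC.
Qed.

End Concatenation.

(** * Length carrots: halves of length John curves *)

Section Carrots.
Context {R : realType} {X : metricType R}.
Implicit Types (G : set X) (a b t L C : R) (g : R -> X) (x y z : X).

(** The tip is [x], and lengths are measured from it. The bound [L] on the total length is recorded
    because extending the curve requires it. *)
Definition carrot G L C x z := exists a b g,
  [/\ joins_in G a b g x z, length_le a b g L &
      forall t, a <= t <= b -> length_le a t g (C * bdist G (g t))].

Lemma carrot_le G L L' C x z : L <= L' -> carrot G L C x z -> carrot G L' C x z.
Proof.
move=> LL [a [b [g [H1 H2 H3]]]]; exists a, b, g; split => //.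
exact: length_le_sub H2.
Qed.

(** On the added piece the length from [x] is simply bounded by the total [L + M]. *)
Lemma carrot_extend G L M C x y z a b g : carrot G L C x y ->
  joins_in G a b g y z -> length_le a b g M ->
  (forall t, a <= t <= b -> L + M <= C * bdist G (g t)) ->
  carrot G (L + M) C x z.
Proof.
move=> [a0 [b0 [g0 [j0 L0 c0]]]] j M0 c.
have [ab0 _ _ _ gb0] := iffLR (joins_inP _ _ _ _ _ _) j0.
have [ab _ _ ga _] := iffLR (joins_inP _ _ _ _ _ _) j.
have e : g0 b0 = g a by rewrite gb0.
have bc : b0 <= b + (b0 - a) by rewrite addrCA lerDl subr_ge0.
have LM : length_le a0 (b + (b0 - a)) (cat_curve b0 a g0 g) (L + M).
  apply: (length_le_cat ab0 bc).
    by apply: length_le_eq L0 => t /andP[_ tb]; rewrite cat_curvel.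
  by have := length_le_catr e (lexx a) M0; rewrite subrKC.
exists a0, (b + (b0 - a)), (cat_curve b0 a g0 g); split => //.
  exact: joins_in_cat j0 j.
move=> t /andP[ta tc]; have [tb|/ltW bt] := leP t b0.
  rewrite cat_curvel//; have := c0 t; rewrite ta tb => /(_ isT).
  by apply: length_le_eq => s /andP[_ st]; rewrite cat_curvel// (le_trans st).
apply: length_le_sub LM => //; rewrite cat_curver//; apply: c.
by apply/andP; split; lra.
Qed.

(** Each step is replaced by a quasiconvexity curve of length at most lambda sigma <= D / 2. It
    starts at distance at least [D] from the complement, so its points keep distance at least D / 2,
    and C D / 2 dominates the total length. *)
Lemma carrot_chain G lambda q L C D sigma (p : nat -> X) n x :
  G `<` setT -> locally_quasiconvex q lambda G ->
  0 < q -> 0 <= lambda -> 0 <= C ->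
  sigma <= q * D -> lambda * sigma <= D / 2 ->
  (forall i, (i <= n)%N -> G (p i) /\ D <= bdist G (p i)) ->
  (forall i, (i < n)%N -> mdist (p i) (p i.+1) < sigma) ->
  L + n%:R * (lambda * sigma) <= C * (D / 2) ->
  carrot G L C x (p 0%N) -> carrot G (L + n%:R * (lambda * sigma)) C x (p n).
Proof.
move=> GT [_ qc] q0 l0 C0 sq lsD pD ps + H0.
elim: n pD ps => [|n IH] pD ps LC; first by rewrite mul0r addr0.
have s0 : 0 <= sigma by rewrite (le_trans _ (ltW (ps 0%N _)))// mdist_ge0.
have ls0 : 0 <= lambda * sigma by rewrite mulr_ge0.
move: LC; rewrite -natr1 mulrDl mul1r addrA => LC.
have {}IH := IH (fun i h => pD i (leqW h)) (fun i h => ps i (leqW h)) _.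
have {}IH : carrot G (L + n%:R * (lambda * sigma)) C x (p n).
  by apply: IH; rewrite (le_trans _ LC)// lerDl.
have [Gn Dn] := pD n (leqnSn n).
(* Positivity comes from the step itself: 0 <= [mdist] < q * [bdist]. *)
have [D0 psn] : 0 < bdist G (p n) /\ mdist (p n) (p n.+1) < q * bdist G (p n).
  have H : mdist (p n) (p n.+1) < q * bdist G (p n).
    by rewrite (lt_le_trans (ps n _))// (le_trans sq)// ler_pM2l.
  split=> //; have := le_lt_trans (mdist_ge0 _ _) H.
  by rewrite pmulr_rgt0.
have [||a [b [g [j gle]]]] := qc (p n) Gn (p n) (p n.+1).
- by apply/ball_mdist; rewrite mdistxx mulr_gt0.
- exact/ball_mdist.
have [ab _ _ ga _] := iffLR (joins_inP _ _ _ _ _ _) j.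
have gl : length_le a b g (lambda * sigma).
  apply/curve_length_leP => //; apply: le_trans gle _.
  by rewrite lee_fin ler_wpM2l// ltW// ps.
apply: (carrot_extend IH j gl) => t /andP[ta tb].
apply: le_trans LC _; rewrite ler_wpM2l//.
have := bdist_lipschitz (p n) (g t) GT.
have := mdist_length_le gl (lexx a) ta tb; rewrite ga; lra.
Qed.

(** The second carrot is run backwards after the first: up to the junction the length from [x] is
    controlled, after it the length to [y]. *)
Lemma carrots_john G C L L' x y z :
  carrot G L C x z -> carrot G L' C y z ->
  exists a b g, [/\ joins_in G a b g x y, rectifiable a b g &
    forall t, t \in `[a, b] ->
      (Order.min (curve_length a t g) (curve_length t b g)
         <= (C * bdist G (g t))%:E)%E].
Proof.
move=> [a [b [g [j Lg c]]]] [a1 [b1 [g1 [/joins_in_rev j' /length_le_rev Lg' c']]]].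
have [ab _ _ _ gb] := iffLR (joins_inP _ _ _ _ _ _) j.
have [ab' _ _ ga _] := iffLR (joins_inP _ _ _ _ _ _) j'.
set g' := (fun t => g1 (- t)) in j' Lg' ga.
set a' := - b1 in j' Lg' ga ab'; set b' := - a1 in j' Lg' ab'.
have e : g b = g' a' by rewrite gb.
have bc : b <= b' + (b - a') by rewrite addrCA lerDl subr_ge0.
exists a, (b' + (b - a')), (cat_curve b a' g g'); split.
- exact: joins_in_cat j j'.
- apply: (@le_lt_trans _ _ (L + L')%:E); last exact: ltry.
  apply/curve_length_leP; first exact: le_trans bc.
  apply: (length_le_cat ab bc).
    by apply: length_le_eq Lg => t /andP[_ tb]; rewrite cat_curvel.
  by have := length_le_catr e (lexx a') Lg'; rewrite subrKC.
move=> t; rewrite in_itv /= => /andP[ta tc]; rewrite ge_min; apply/orP.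
have [tb|/ltW bt] := leP t b.
  left; rewrite cat_curvel//; apply/curve_length_leP => //.
  have := c t; rewrite ta tb => /(_ isT).
  by apply: length_le_eq => s /andP[_ st]; rewrite cat_curvel// (le_trans st).
right; rewrite cat_curver//; apply/curve_length_leP => //.
have u1 : a1 <= - (t - (b - a')) <= b1 by apply/andP; rewrite /a' /b' in tc *; split; lra.
have /length_le_rev := c' _ u1; rewrite opprK => H.
have := length_le_catr e _ H; rewrite subrK; apply; lra.
Qed.

End Carrots.

(** * Doubling iterated over dyadic scales *)

Section Doubling.
Context {R : realType} {X : metricType R}.
Implicit Types (x y z u v : X) (s : seq X) (r sigma : R).

Definition seq_separated sigma s :=
  forall u v, u \in s -> v \in s -> u != v -> sigma <= mdist u v.

(** Greedy selection: a point is kept only if no kept point is closer than [sigma]. *)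
Lemma separated_net sigma s : uniq s -> 0 < sigma -> exists t,
  [/\ uniq t, {subset t <= s}, seq_separated sigma t &
      forall u, u \in s -> exists2 v, v \in t & mdist v u < sigma].
Proof.
move=> + s0; elim: s => [|x s IH] /=; first by exists [::].
move=> /andP[xs /IH[t [t1 t2 t3 t4]]].
have [[v vt vx]|nx] := pselect (exists2 v, v \in t & mdist v x < sigma).
  exists t; split => // [u /t2 us|u]; first by rewrite inE us orbT.
  by rewrite inE => /predU1P[->|/t4//]; exists v.
have xt v : v \in t -> sigma <= mdist v x.
  by move=> vt; rewrite leNgt; apply/negP => vx; apply: nx; exists v.
exists (x :: t); split => /=.
- by rewrite t1 andbT; apply/negP => /t2; rewrite (negbTE xs).
- move=> u; rewrite !inE => /predU1P[->|/t2 ->]; first by rewrite eqxx.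
  by rewrite orbT.
- move=> u v; rewrite !inE => /predU1P[->|ut] /predU1P[->|vt].
  + by rewrite eqxx.
  + by rewrite metric_sym => _; exact: xt.
  + by move=> _; exact: xt.
  + exact: t3.
- move=> u; rewrite inE => /predU1P[->|/t4[v vt vu]].
    by exists x; rewrite ?mem_head// mdistxx.
  by exists v => //; rewrite inE vt orbT.
Qed.

(** Pigeonhole, one class at a time: removing the items of the first class removes at most [N] of
    them. *)
Lemma size_cover (T : eqType) (N : nat) (P : T -> pred T) (t l : seq T) :
  (forall i, i \in l -> has (P^~ i) t) ->
  (forall j, j \in t -> (count (P j) l <= N)%N) -> (size l <= size t * N)%N.
Proof.
elim: t l => [|j t IH] l H1 H2 /=.
  by case: l H1 {H2} => // i l /(_ i (mem_head _ _)).
rewrite mulSn -(count_predC (P j) l) leq_add ?H2 ?mem_head//.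
rewrite -size_filter; apply: IH => [i|k kt].
  by rewrite mem_filter /= => /andP[/negbTE Pi /H1] /=; rewrite Pi.
rewrite (leq_trans _ (H2 k _)) ?inE ?kt ?orbT//.
by rewrite count_filter; apply: sub_count => i /= /andP[].
Qed.

Lemma doubling_seq Q x r s : doubling X Q -> 0 < r -> uniq s ->
  (forall u, u \in s -> mdist x u < r) -> seq_separated (r / 2) s ->
  (size s)%:R <= Q.
Proof.
move=> dQ r0 us sx ss.
have [|n sn nQ] := dQ x r r0 [set` s] _ ss.
  by move=> u /= /sx; rewrite ball_mdist.
suff -> : size s = n by [].
apply/card_eq_II; apply: card_eq_trans sn; rewrite card_eq_sym.
have -> : [set` s] = nth x s @` `I_(size s).
  apply/seteqP; split => [u /= su|_ [i si <-]]; last exact: mem_nth.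
  by exists (index u s); [rewrite /= index_mem|rewrite nth_index].
apply: inj_card_eq => i j; rewrite !inE /= => si sj /eqP.
by rewrite nth_uniq// => /eqP.
Qed.

(** An r/2-separated net of the list has at most [K] points by doubling, and the r/2-balls around it
    cover the list; each is handled by the previous exponent. This gives N = K^(m+1). *)
Lemma doubling_iter Q : doubling X Q -> forall m, exists N : nat,
  forall x r s, 0 < r -> uniq s -> (forall u, u \in s -> mdist x u < r) ->
    seq_separated (r / 2 ^+ m) s -> (size s <= N)%N.
Proof.
move=> dQ; pose K := Num.truncn Q.
have dK x r s : 0 < r -> uniq s -> (forall u, u \in s -> mdist x u < r) ->
    seq_separated (r / 2) s -> (size s <= K)%N.
  move=> r0 us sx ss; have sQ := doubling_seq dQ r0 us sx ss.
  by rewrite truncn_ge_nat// (le_trans _ sQ).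
elim => [|m [N IH]].
  exists K => x r s r0 us sx ss; apply: (dK x r) => // u v su sv uv.
  have := ss u v su sv uv; rewrite expr0 divr1; lra.
exists (K * N)%N => x r s r0 us sx ss; have r20 : 0 < r / 2 by rewrite divr_gt0.
have [t [t1 t2 t3 t4]] := separated_net us r20.
have tK : (size t <= K)%N by apply: (dK x r) => // u /t2/sx.
rewrite (leq_trans _ (leq_mul tK (leqnn N)))//.
apply: (@size_cover _ N (fun v u => mdist v u < r / 2)) => [u /t4[v vt vu]|v vt].
  by apply/hasP; exists v.
rewrite -size_filter; apply: (IH v (r / 2)); rewrite ?filter_uniq//.
  by move=> u; rewrite mem_filter => /andP[].
move=> u w; rewrite !mem_filter => /andP[_ su] /andP[_ sw] uw.
by rewrite -mulrA -invfM -exprS; exact: ss.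
Qed.

End Doubling.

(** * Chains in connected sets *)

Section Chains.
Context {R : realType} {X : metricType R}.
Implicit Types (E : set X) (x y z u v : X) (sigma : R).

Lemma metric_ball_open x sigma : open (ball x sigma).
Proof.
rewrite openE => y /ball_mdist xy; apply/nbhs_ballP.
exists (sigma - mdist x y) => /= [|z /ball_mdist yz]; first by rewrite subr_gt0.
by apply/ball_mdist; have := metric_triangle x y z; lra.
Qed.

Definition chain E sigma n (p : nat -> X) :=
  (forall i, (i <= n)%N -> E (p i)) /\
  (forall i, (i < n)%N -> mdist (p i) (p i.+1) < sigma).

Definition chained E sigma u v n :=
  exists p : nat -> X, [/\ chain E sigma n p, p 0%N = u & p n = v].

(** The set [B] of reachable points is relatively clopen: [E] meets the sigma-neighbourhood of [B]
    only in [B], and that of its complement in [E] only outside [B]. *)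
Lemma connected_chained E sigma u v : connected E -> 0 < sigma -> E u -> E v ->
  exists n, chained E sigma u v n.
Proof.
move=> Ec s0 Eu Ev.
pose B := [set w | E w /\ exists n, chained E sigma u w n].
have Bstep w w' : B w -> E w' -> mdist w w' < sigma -> B w'.
  move=> [Ew [n [p [[p1 p2] p0 pn]]]] Ew' ww'; split => //.
  exists n.+1, (fun i => if (i <= n)%N then p i else w'); split; last 2 first.
  - by rewrite /= p0.
  - by rewrite /= ltnn.
  split=> i; first by case: ifP => // + _; exact: p1.
  rewrite ltnS => ii; rewrite ii; case: ifP => [/p2//|/negbT].
  by rewrite -leqNgt => ni; rewrite (_ : i = n) ?pn//; lia.
have oU (A : set X) : open (\bigcup_(w in A) ball w sigma).
  by apply: bigcup_open => w _; exact: metric_ball_open.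
suff BE : B = E by have [] : B v by rewrite BE.
apply: Ec.
- exists u; split => //; by exists 0%N, (fun=> u).
- exists (\bigcup_(w in B) ball w sigma) => //; apply/seteqP; split => [w Bw|w].
    by split; [case: Bw|exists w => //; apply/ball_mdist; rewrite mdistxx].
  by move=> [Ew [w' Bw' /ball_mdist ww']]; exact: Bstep Bw' Ew ww'.
- exists (~` \bigcup_(w in E `\` B) ball w sigma); first exact: open_closedC.
  apply/seteqP; split => [w Bw|w [Ew H]].
    split; first by case: Bw.
    move=> [w' [Ew' nBw'] /ball_mdist ww']; apply: nBw'.
    by apply: Bstep Bw Ew' _; rewrite metric_sym.
  apply: contrapT => nB; apply: H; exists w => //.
  by apply/ball_mdist; rewrite mdistxx.
Qed.

(* In a chain with the least number of steps, a pair of non-consecutive points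
   less than sigma apart would give a shortcut. *)
Lemma short_chain E sigma u v : connected E -> 0 < sigma -> E u -> E v ->
  exists n p, [/\ chain E sigma n p, p 0%N = u, p n = v &
    forall i j, (i.+1 < j)%N -> (j <= n)%N -> sigma <= mdist (p i) (p j)].
Proof.
move=> Ec s0 Eu Ev; have [n0 n0P] := connected_chained Ec s0 Eu Ev.
have ex : exists n, `[< chained E sigma u v n >] by exists n0; exact/asboolP.
case: (ex_minnP ex) => n /asboolP[p [[p1 p2] p0 pn]] nmin.
exists n, p; split => // i j ij jn; rewrite leNgt; apply/negP => pij.
have : (n <= n - (j - i.+1))%N.
  apply: nmin; apply/asboolP.
  exists (fun k => if (k <= i)%N then p k else p (k + (j - i.+1))%N); split.
  - split=> k kn; first by case: ifP => ki; apply: p1; lia.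
    case: ifP => ki; case: ifP => ki'.
    + by apply: p2; lia.
    + have -> : k = i by lia.
      by have -> : (i.+1 + (j - i.+1) = j)%N by lia.
    + by lia.
    + by rewrite addSn; apply: p2; lia.
  - by [].
  - by case: ifP => ki; [lia|rewrite subnK//; lia].
by lia.
Qed.

(** In a shortest chain the points of even index are pairwise non-consecutive, hence r /
    2^m-separated; doubling bounds their number and so [n]. *)
Lemma bounded_chain Q m : doubling X Q -> exists N : nat,
  forall E x (r : R) u v, connected E -> 0 < r -> E u -> E v ->
    (forall w, E w -> mdist x w < r) ->
    exists n p, [/\ (n <= N)%N, chain E (r / 2 ^+ m) n p, p 0%N = u & p n = v].
Proof.
move=> /doubling_iter/(_ m)[N NP]; exists (N.*2)%N => E x r u v Ec r0 Eu Ev Er.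
have s0 : 0 < r / 2 ^+ m by rewrite divr_gt0// exprn_gt0.
have [n [p [[p1 p2] p0 pn sep]]] := short_chain Ec s0 Eu Ev.
exists n, p; split => //.
have sep2 i j : (i < j)%N -> (j.*2 <= n)%N -> r / 2 ^+ m <= mdist (p i.*2) (p j.*2).
  by move=> ij jn; apply: sep; lia.
have dd i j : (i < j)%N -> (j.*2 <= n)%N -> p i.*2 != p j.*2.
  move=> ij jn; apply/eqP => pij; have := sep2 i j ij jn.
  by rewrite pij mdistxx leNgt s0.
have := NP x r (mkseq (fun i => p i.*2) n./2.+1) r0; rewrite size_mkseq.
have half i : (i <= n./2)%N -> (i.*2 <= n)%N by lia.
have H : (n./2.+1 <= N)%N -> (n <= N.*2)%N by lia.
move=> K; apply: H; apply: K.
- apply/(uniqP (p 0%N)) => i j; rewrite !inE size_mkseq => ii jj.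
  rewrite !nth_mkseq// => pij; have [ij|ij|//] := ltngtP i j.
    by have := dd i j ij (half _ jj); rewrite pij eqxx.
  by have := dd j i ij (half _ ii); rewrite pij eqxx.
- by move=> w /mapP[i]; rewrite mem_iota /= add0n ltnS => ii ->; apply: Er; exact/p1/half.
- move=> w w' /mapP[i + ->] /mapP[j + ->]; rewrite !mem_iota /= !add0n !ltnS => ii jj.
  have [ij|ij|->] := ltngtP i j; last by rewrite eqxx.
    by move=> _; apply: sep2 ij (half _ jj).
  by move=> _; rewrite metric_sym; apply: sep2 ij (half _ ii).
Qed.

End Chains.

(** * From distance carrots to length carrots *)

Section DistanceCarrots.
Context {R : realType} {X : metricType R}.
Implicit Types (G : set X) (a b s t u v c : R) (g : R -> X) (x y z : X).

(** [s] is the supremum of the parameters up to which the curve stays within distance [M] of [x].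
    Continuity at [s] gives both inequalities there; the point farther than [M] ensures s < b,
    leaving room beyond [s]. *)
Lemma first_hit a b g x (M : R) : eps_continuous a b g -> mdist x (g a) <= M ->
  (exists2 u, a <= u <= b & M < mdist x (g u)) ->
  exists s, [/\ a <= s <= b, M <= mdist x (g s) &
    forall v, a <= v <= s -> mdist x (g v) <= M].
Proof.
move=> gc xa [u0 /andP[au0 u0b] Mu0].
pose A := [set u | a <= u <= b /\ forall v, a <= v <= u -> mdist x (g v) <= M].
have Aa : A a.
  split=> [|v va]; first by rewrite lexx (le_trans au0).
  by rewrite (le_anti va : a = v) in xa *.
have Ab : ubound A b by move=> u [/andP[]].
have supA : has_sup A by split; [exists a|exists b].
set s := sup A.
have as_ : a <= s by exact: ub_le_sup supA.2 _ Aa.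
have sb : s <= b by exact: ge_sup supA.1 Ab.
have sab : a <= s <= b by rewrite as_.
have lt_s v : a <= v -> v < s -> mdist x (g v) <= M.
  by move=> av /(sup_gt supA.1)[u [_ uA] vu]; apply: uA; rewrite av ltW.
have s_le : mdist x (g s) <= M.
  rewrite leNgt; apply/negP => Ms.
  have [d d0 dP] := gc s sab (mdist x (g s) - M) ltac:(lra).
  have as' : a < s by rewrite lt_neqAle as_ andbT; apply/eqP => e; move: Ms; rewrite -e; lra.
  pose u := Num.max a (s - d / 2).
  have au : a <= u by rewrite le_max lexx.
  have us : u < s by rewrite gt_max as' /=; lra.
  have su : `|s - u| < d.
    rewrite ger0_norm ?subr_ge0; last exact: ltW.
    have : s - d / 2 <= u by rewrite le_max lexx orbT.
    lra.
  have := dP u _ su; rewrite au (le_trans (ltW us) sb) => /(_ isT).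
  have := lt_s u au us; have := metric_triangle x (g u) (g s).
  by rewrite (metric_sym (g u)); lra.
have le_s v : a <= v <= s -> mdist x (g v) <= M.
  by move=> /andP[av]; rewrite le_eqVlt => /predU1P[->//|]; exact: lt_s.
exists s; split => //; rewrite leNgt; apply/negP => Ms.
have [d d0 dP] := gc s sab (M - mdist x (g s)) ltac:(lra).
have sb' : s < b.
  apply: lt_le_trans u0b; rewrite ltNge; apply/negP => u0s.
  by have := le_s u0; rewrite au0 u0s => /(_ isT); lra.
pose u := Num.min b (s + d / 2).
have ub : u <= b by rewrite ge_min lexx.
have su : s < u by rewrite lt_min sb' /=; lra.
have ud : u <= s + d / 2 by rewrite ge_min lexx orbT.
have : u <= s.
  apply: (ub_le_sup supA.2); split=> [|v /andP[av vu]].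
    by rewrite ub (le_trans as_)// ltW.
  have [vs|sv] := leP v s; first by apply: le_s; rewrite av.
  have := dP v; rewrite av (le_trans vu ub) => /(_ isT).
  rewrite distrC ger0_norm ?subr_ge0; last exact: ltW.
  have := metric_triangle x (g s) (g v); lra.
by rewrite leNgt su.
Qed.

(** What half of a diameter John curve provides: the diameter of the part before [u] enters only
    through distances to the tip [g a]. *)
Definition distance_carrot G c a b g := forall u v, a <= v -> v <= u -> u <= b ->
  mdist (g a) (g v) <= c * bdist G (g u).

(** The balance point of the diameters is a supremum, so the bound is first known only strictly
    before it; continuity carries it to the endpoint. *)
Lemma distance_carrot_closure G c a b g : G `<` setT -> 0 <= c ->
  a <= b -> eps_continuous a b g -> 0 <= bdist G (g b) ->
  (forall u v, a <= v -> v <= u -> u < b -> mdist (g a) (g v) <= c * bdist G (g u)) ->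
  distance_carrot G c a b g.
Proof.
move=> GT c0 ab gc Gb H u v av vu; rewrite le_eqVlt => /predU1P[ub|]; last exact: H.
subst u; have [e|nab] := eqVneq a b.
  by rewrite (_ : v = a) ?mdistxx ?mulr_ge0//; lra.
have {nab}ab' : a < b by rewrite lt_neqAle nab.
rewrite leNgt; apply/negP => K.
(* Moving a point by [e] changes the left side by at most [e] and the right side by at most [c * e],
   together exactly the gap. *)
pose e := (mdist (g a) (g v) - c * bdist G (g b)) / (c + 1).
have e0 : 0 < e by rewrite divr_gt0//; lra.
have eE : e + c * e = mdist (g a) (g v) - c * bdist G (g b).
  by rewrite /e; field; rewrite lt0r_neq0//; lra.
have [d d0 dP] := gc b ltac:(rewrite ab lexx//) e e0.
have near w : a <= w -> w < b -> b - d < w ->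
    mdist (g b) (g w) < e /\ c * bdist G (g w) <= c * bdist G (g b) + c * e.
  move=> aw wb bw; have bwe : mdist (g b) (g w) < e.
    by apply: dP; rewrite ?aw ?ltW// ger0_norm; lra.
  split=> //; rewrite -mulrDr ler_wpM2l//.
  have := bdist_lipschitz (g w) (g b) GT; rewrite metric_sym; lra.
pose w0 := Num.max a (b - d / 2).
have aw0 : a <= w0 by rewrite le_max lexx.
have w0b : w0 < b by rewrite gt_max ab' /=; lra.
have bw0 : b - d < w0 by rewrite lt_max; apply/orP; right; lra.
(* If v = b, both sides are compared at the nearby [w0]; otherwise [v] is kept and only [u] moves,
   to some w >= v near [b]. *)
move: vu; rewrite le_eqVlt => /predU1P[vb|vb].
  subst v; have [n1 n2] := near w0 aw0 w0b bw0.
  have := H w0 w0 aw0 (lexx _) w0b; have := metric_triangle (g a) (g w0) (g b).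
  rewrite (metric_sym (g w0)); lra.
pose w := Num.max v w0.
have vw : v <= w by rewrite le_max lexx.
have wb : w < b by rewrite gt_max vb.
have bw : b - d < w by rewrite lt_max bw0 orbT.
have [_ n2] := near w (le_trans av vw) wb bw.
have := H w v av vw wb; lra.
Qed.

Lemma carrot_point G C x : G x -> 0 <= C -> 0 <= bdist G x -> carrot G 0 C x x.
Proof.
move=> Gx C0 Dx.
have L0 : length_le 0 0 (fun=> x) (0 : R).
  by move=> t n _ _; rewrite big1// => i _; rewrite mdistxx.
exists 0, 0, (fun=> x); split => //.
  by apply/joins_inP; split => // t _ e e0; exists 1 => // u _ _; rewrite mdistxx.
move=> t t0; rewrite -(le_anti t0).
by apply: length_le_sub L0; rewrite ?mulr_ge0.
Qed.

Lemma exp2_ge (r : R) : exists k, r <= 2 ^+ k.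
Proof.
exists (Num.truncn r).+1; apply: le_trans (ltW (truncnS_gt r)) _.
by rewrite -natrX ler_nat ltnW// ltn_expl.
Qed.

Lemma distance_carrot_carrot Q q lambda c : doubling X Q ->
  0 < q -> q < 1 -> 1 <= lambda -> 1 <= c ->
  exists2 C, 1 <= C & forall G, G `<` setT -> open G ->
    locally_quasiconvex q lambda G ->
    forall a b g x z, joins_in G a b g x z -> distance_carrot G c a b g ->
      exists L, carrot G L C x z.
Proof.
move=> dQ q0 q1 l1 c1.
(* The chain at scale [M] lies in a ball of radius 4 M and has steps below 4 M / 2^m, whence the
   factor 4. *)
have [m mP] := exp2_ge (4 * (2 * c * lambda) / q).
have [N NP] := bounded_chain m dQ.
(* kappa makes steps of size kappa M fit both the quasiconvexity balls of radius
   q M / c and the requirement lambda kappa M <= M / (2 c), which keeps the new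
   curves at distance >= M / (2 c) from the complement of G. *)
pose kappa : R := 4 / 2 ^+ m.
have p2 : 0 < 2 ^+ m :> R by rewrite exprn_gt0.
have k0 : 0 < kappa by rewrite divr_gt0.
have kP : kappa * (2 * c * lambda) <= q.
  by rewrite /kappa mulrAC ler_pdivrMr// [leRHS]mulrC -ler_pdivrMr.
have cl1 : 1 <= c * lambda by rewrite mulr_ege1.
have Nk : 0 <= N%:R * (lambda * kappa) by rewrite !mulr_ge0//; lra.
(* The first term pays for the initial curve, of length at most 2 lambda r0; the second pays for one
   scale, with at most [N] curves of length lambda kappa M. *)
pose C1 := 2 * lambda + N%:R * (lambda * kappa).
have C11 : 1 <= C1 by rewrite /C1; lra.
(* At scale [M] the total length is at most 2 C1 M, and the new curves keep distance at least M / (2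
   c) from the complement. *)
pose C := 4 * c * C1.
have C1' : 1 <= C by rewrite /C -mulrA mulr_ege1//; [lra|rewrite mulr_ege1].
exists C => // G GT Go qc a b g x z j dc.
have [ab gc gG ga gb] := iffLR (joins_inP _ _ _ _ _ _) j.
have Gx : G x by rewrite -ga; apply: gG; rewrite lexx.
have Dx := bdist_gt0 GT Go Gx; set D := bdist G x in Dx.
pose r0 := q * D / (8 * lambda).
have r00 : 0 < r0 by rewrite divr_gt0 ?mulr_gt0//; lra.
have lr0 : lambda * (2 * r0) = q * D / 4 by rewrite /r0; field; rewrite ?lt0r_neq0//; lra.
have qD : q * D < D by rewrite gtr_pMl.
have r0D : 2 * r0 <= q * D / 4.
  by rewrite -lr0 ler_peMl//; lra.
(* The length bound is linear in the radius 2^k r0, which encodes the geometric sum. A large [k]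
   covers the whole curve, whose points are all within c * [bdist G (g b)] of [x]. *)
suff main k s : a <= s <= b ->
    (forall v, a <= v <= s -> mdist x (g v) <= 2 ^+ k * r0) ->
    carrot G (C1 * (2 ^+ k * r0)) C x (g s).
  have [k kP'] := exp2_ge (c * bdist G (g b) / r0).
  exists (C1 * (2 ^+ k * r0)); rewrite -gb; apply: main; first by rewrite ab lexx.
  move=> v /andP[av vb]; apply: (@le_trans _ _ (c * bdist G (g b))).
    by rewrite -ga; exact: dc.
  by rewrite -ler_pdivrMr.
elim: k s => [|k IH] s /andP[as_ sb] sP.
  rewrite expr0 mul1r in sP *.
  have xs : mdist x (g s) <= r0 by apply: sP; rewrite as_ lexx.
  (* A single step from [x] to [g s]; the factor 2 turns the bound [r0] on their distance into a
     strict one. *)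
  apply: (@carrot_le _ _ _ (0 + 1%:R * (lambda * (2 * r0)))).
    rewrite add0r mul1r mulrA (mulrC lambda) ler_wpM2r//; first exact: ltW.
    by rewrite /C1; lra.
  pose p i := if i is 0%N then x else g s.
  apply: (@carrot_chain _ _ G lambda q 0 C (D / 2) (2 * r0) p 1 x) => //; try lra.
  - move=> [|i] _ /=; first by split=> //; rewrite -/D; lra.
    split; first by apply: gG; rewrite as_.
    have := bdist_lipschitz x (g s) GT; rewrite -/D; lra.
  - by move=> [|//] _ /=; lra.
  - rewrite lr0; have : D / 4 <= C * (D / 2 / 2); last lra.
    by rewrite (_ : D / 2 / 2 = D / 4); [rewrite ler_peMl; lra|lra].
  - by apply: carrot_point => //; [lra|rewrite -/D; lra].
set M := 2 ^+ k * r0 in IH.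
have M0 : 0 < M by rewrite mulr_gt0// exprn_gt0.
have E2 : 2 ^+ k.+1 * r0 = 2 * M by rewrite exprS -mulrA.
rewrite E2 in sP *; clearbody M.
(* If the curve stays within distance [M], the previous scale suffices; otherwise the old carrot
   ends at the exit point [g s1] and only the piece from [s1] to [s] is new. *)
have [sM|/existsNP[u0 /not_implyP[u0s /negP]]] :=
    pselect (forall v, a <= v <= s -> mdist x (g v) <= M).
  apply: carrot_le (IH s _ sM); last by rewrite as_.
  by rewrite ler_wpM2l//; lra.
rewrite -ltNge => u0M.
have [|||s1 [/andP[as1 s1s] Ms1 s1P]] := @first_hit a s g x M.
- exact: eps_continuous_sub gc.
- by rewrite ga mdistxx ltW.
- by exists u0.
have IH1 := IH s1 ltac:(rewrite as1 (le_trans s1s)//) s1P.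
pose E := g @` [set` `[s1, s]].
have Ec : connected E.
  apply: connected_continuous_connected; first exact: segment_connected.
  by apply/eps_continuousP; exact: eps_continuous_sub gc.
have EP w : E w -> [/\ G w, M / c <= bdist G w & mdist x w <= 2 * M].
  move=> [u + <-]; rewrite /= in_itv /= => /andP[s1u us]; split.
  - by apply: gG; rewrite (le_trans as1)// (le_trans us).
  - rewrite ler_pdivrMr; last lra.
    (* The distance carrot condition is used with v = s1, where the distance to [x] is at least
       [M]. *)
    rewrite mulrC (le_trans Ms1)// -ga; apply: dc => //.
    exact: le_trans us sb.
  - by apply: sP; rewrite us (le_trans as1).
have M40 : 0 < 4 * M by lra.
have [||w /EP[]|n [p [nN [p1 p2'] p0 pn]]] := NP E x (4 * M) (g s1) (g s) Ec M40.
- by exists s1; rewrite //= in_itv /= lexx.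
- by exists s; rewrite //= in_itv /= lexx andbT.
- by lra.
have sE : 4 * M / 2 ^+ m = kappa * M by rewrite /kappa mulrAC.
have Mc : M / c <= M by rewrite ler_pdivrMr ?ler_peMr//; lra.
rewrite sE in p2'; clear mP sE; clearbody kappa.
have lk : lambda * kappa <= 1 / (2 * c).
  rewrite ler_pdivlMr; last lra.
  by move: kP; rewrite (_ : _ * (_ * _ * _) = lambda * kappa * (2 * c)); [lra|ring].
have nk : n%:R * (lambda * (kappa * M)) <= C1 * M.
  rewrite !mulrA ler_wpM2r//; first exact: ltW.
  rewrite -mulrA (@le_trans _ _ (N%:R * (lambda * kappa)))//.
    by rewrite ler_wpM2r ?ler_nat// mulr_ge0; lra.
  by rewrite /C1; lra.
have CM : C * (M / c / 2) = 2 * (C1 * M) by rewrite /C; field; rewrite ?lt0r_neq0//; lra.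
apply: (@carrot_le _ _ _ (C1 * M + n%:R * (lambda * (kappa * M)))).
  by rewrite mulrCA; lra.
rewrite -pn; apply: (@carrot_chain _ _ G lambda q (C1 * M) C (M / c) (kappa * M) p n x) => //.
- by lra.
- by lra.
- rewrite mulrA mulrAC ler_wpM2r//; first exact: ltW.
  rewrite ler_pdivlMr; last lra.
  apply: le_trans kP; rewrite ler_wpM2l//; first exact: ltW.
  by rewrite mulrAC ler_peMl//; [lra|nra].
- rewrite !mulrA; rewrite [leRHS](_ : _ = 1 / (2 * c) * M); last by field; rewrite ?lt0r_neq0//; lra.
  by rewrite ler_wpM2r// ltW.
- by move=> i /p1/EP[].
- by rewrite CM; lra.
- by rewrite p0.
Qed.

End DistanceCarrots.

(** * Cutting a diameter John curve where its diameters balance *)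

Theorem theorem1p1 (R : realType) (X : metricType R)
  (Q : R) (hQ : 1 < Q) (hX : doubling X Q)
  (q lambda : R) (hq0 : 0 < q) (hq1 : q < 1) (hlambda : 1 <= lambda)
  (G : set X) (hGproper : G `<` setT) (hGdomain : is_domain G)
  (hGqc : locally_quasiconvex q lambda G) :
  length_john G <-> diameter_john G.
Proof.
split=> -[c c1 cG].
  exists c => // x y Gx Gy; have [a [b [g [j rg H]]]] := cG x y Gx Gy.
  exists a, b, g; split => // t /H; apply: le_trans.
  by rewrite le_min !ge_min !curve_diam_le_length !orbT.
have [_ Go _] := hGdomain.
have [C C1 CP] := distance_carrot_carrot hX hq0 hq1 hlambda c1.
exists C => // x y Gx Gy; have [a [b [g [j _ H]]]] := cG x y Gx Gy.
have [ab gc gG ga gb] := iffLR (joins_inP _ _ _ _ _ _) j.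
(* The initial diameter grows and the terminal one shrinks with [t], so they balance at the supremum
   of [A]. *)
pose A := [set t | a <= t <= b /\ (curve_diam a t g <= curve_diam t b g)%E].
have Aa : A a by split; [rewrite lexx ab|exact: curve_diam_sub].
have supA : has_sup A by split; [exists a|exists b => u [/andP[]]].
set s := sup A.
have as_ : a <= s by exact: ub_le_sup supA.2 _ Aa.
have sb : s <= b by apply: ge_sup supA.1 _ => u [/andP[]].
have Gs : G (g s) by apply: gG; rewrite as_.
have Ds := ltW (bdist_gt0 hGproper Go Gs).
have c0 : 0 <= c by lra.
have [L1 carrot1] : exists L, carrot G L C x (g s).
  apply: (CP G hGproper Go hGqc a s g).
    apply/joins_inP; split => //; first exact: eps_continuous_sub gc.
    by move=> t /andP[at_ ts]; apply: gG; rewrite at_ (le_trans ts).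
  apply: distance_carrot_closure => //; first exact: eps_continuous_sub gc.
  move=> u v av vu us; have au := le_trans av vu.
  have ub := le_trans (ltW us) sb.
  have := H u; rewrite in_itv /= au ub => /(_ isT).
  (* Some [w] in [A] lies beyond [u]; by monotonicity the minimum at [u] is the initial diameter. *)
  rewrite min_l; last first.
    have [w [/andP[aw wb] wA] uw] := sup_gt supA.1 us.
    apply: le_trans (curve_diam_sub _ (lexx a) (ltW uw)) _.
    exact: le_trans wA (curve_diam_sub _ (ltW uw) (lexx b)).
  rewrite -lee_fin; apply: le_trans; apply: mdist_curve_diam.
    by rewrite lexx au.
  by rewrite av vu.
have [L2 carrot2] : exists L, carrot G L C y (g s).
  (* The second half is reversed so that its tip is [y]. *)
  apply: (CP G hGproper Go hGqc (- b) (- s) (fun t => g (- t))).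
    have -> : g s = g (- - s) by rewrite opprK.
    apply: (@joins_in_rev _ _ G s b g).
    apply/joins_inP; split; rewrite ?opprK//; first exact: eps_continuous_sub gc.
    by move=> t /andP[st tb]; apply: gG; rewrite tb (le_trans as_).
  apply: distance_carrot_closure => //; rewrite ?lerN2 ?opprK//.
    by apply: eps_continuous_rev; exact: eps_continuous_sub gc.
  move=> u v bv vu us; have su : s < - u by rewrite ltrNr.
  have ub : - u <= b by rewrite lerNl (le_trans bv).
  have au := le_trans as_ (ltW su).
  have := H (- u); rewrite in_itv /= au ub => /(_ isT).
  (* The parameter [- u] exceeds the supremum, hence is outside [A], and the minimum is the terminal
     diameter. *)
  rewrite min_r; last first.
    apply/ltW; rewrite ltNge; apply/negP => uA.
    have : - u <= s by apply: (ub_le_sup supA.2); rewrite /A /= au ub.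
    by rewrite leNgt su.
  rewrite -lee_fin; apply: le_trans; apply: mdist_curve_diam.
    by rewrite lexx ub.
  by rewrite lerN2 vu lerNl bv.
exact: carrots_john carrot1 carrot2.
Qed.
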